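(* The soft topological groups (as objects) and the morphisms of soft topological groups (as morphisms) form a category, with composition $(\varphi_2,\varrho_2)\circ(\varphi_1,\varrho_1)=(\varphi_2\circ\varphi_1,\varrho_2\circ\varrho_1)$ for $(\varphi_1,\varrho_1)\colon(G_1,\zeta_1)_{\xi_1}\to(G_2,\zeta_2)_{\xi_2}$ and $(\varphi_2,\varrho_2)\colon(G_2,\zeta_2)_{\xi_2}\to(G_3,\zeta_3)_{\xi_3}$, and with identity morphisms $(\mathbb{I}_\xi,\mathbb{I}_G)\colon(G,\zeta)_\xi\to(G,\zeta)_\xi$.
   Context: A soft set over a set $X$ with parameter set $\xi$ is a function $W\colon\xi\to\mathcal{P}(X)$. Soft union, soft intersection and soft inclusion $\widetilde{\sqsubseteq}$ of soft sets with the same parameter set are taken parameterwise; if $\eta\subseteq\xi$, a soft set $V$ with parameter set $\eta$ satisfies $V\,\widetilde{\sqsubseteq}\,W$ if $V(e)\subseteq W(e)$ for all $e\in\eta$. $\emptyset_\xi(e)=\emptyset$ and $X_\xi(e)=X$ for all $e\in\xi$. For $x\in X$, $x\,\widetilde{\in}\,W$ means $x\in W(e)$ for every parameter $e$ of $W$. A soft topology $\zeta$ on $X$ with parameter set $\xi$ is a collection of soft sets over $X$ (with parameter set $\xi$) containing $\emptyset_\xi$ and $X_\xi$ and closed under arbitrary soft unions and under soft intersections of two members; members of $\zeta$ are soft open. A soft open neighborhood of $x$ is a $W\in\zeta$ with $x\,\widetilde{\in}\,W$. For functions $\varphi\colon\xi\to\xi'$ and $\varrho\colon X\to X'$, the image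 $(\varphi,\varrho)(W)$ of a soft set $W$ over $X$ is the soft set over $X'$ with parameter set $\varphi(\xi)$ given by $(\varphi,\varrho)(W)(d)=\bigcup_{\varphi(e)=d}\varrho(W(e))$. The pair $(\varphi,\varrho)\colon(X,\zeta)_\xi\to(X',\zeta')_{\xi'}$ is soft continuous if for every $x\in X$ and every soft open neighborhood $W'$ of $\varrho(x)$ there is a soft open neighborhood $W$ of $x$ with $\varrho(x)\,\widetilde{\in}\,(\varphi,\varrho)(W)\,\widetilde{\sqsubseteq}\,W'$. A soft topological group $(G,\zeta)_\xi$ is a group $(G,\ast)$ with a soft topology $\zeta$ on $G$ with parameter set $\xi$ such that (i) for all $a,b\in G$ and every soft open neighborhood $W$ of $a\ast b$ there are soft open neighborhoods $U$ of $a$ and $V$ of $b$ with $U\ast V\,\widetilde{\sqsubseteq}\,W$, where $(U\ast V)(e)=U(e)\ast V(e)$; and (ii) with $\iota(a)=a^{-1}$, the mapping $(\mathbb{I}_\xi,\iota)$ from $(G,\zeta)_\xi$ to itself is soft continuous. A morphism of soft topological groups $(\varphi,\varrho)\colon(G,\zeta)_\xi\to(G',\zeta')_{\xi'}$ is a soft continuous mapping with $\varphi\colon\xi\to\xi'$ a function and $\varrho\colon G\to G'$ a group homomorphism. Two morphisms $(\varphi_1,\varrho_1),(\varphi_2,\varrho_2)$ are equal iff $\varphi_1=\varphi_2$ and $\varrho_1=\varrho_2$. *)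

(* Defs.v *)
From HB Require Import structures.
From mathcomp Require Import all_boot monoid.
From mathcomp Require Import boolp classical_sets.

Set Implicit Arguments.
Unset Strict Implicit.
Unset Printing Implicit Defensive.

Local Open Scope classical_set_scope.
Local Open Scope group_scope.

(* The parameter set is a type [E]; a smaller parameter set is a set
   [eta : set E], turned into a type by the coercion [set_type]. *)
Definition soft_set (X E : Type) := E -> set X.

Section SoftSets.
Variables X E : Type.
Implicit Types (W V : soft_set X E) (x : X).

Definition soft_empty : soft_set X E := fun=> set0.
Definition soft_full : soft_set X E := fun=> setT.
Definition soft_bigcup (F : set (soft_set X E)) : soft_set X E :=
  fun e => \bigcup_(W in F) W e.
Definition soft_cap W V : soft_set X E := fun e => W e `&` V e.
Definition soft_mem x W := forall e, W e x.
Definition soft_sub V W := forall e, V e `<=` W e.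
Definition soft_sub_on (eta : set E) (V : soft_set X eta) W :=
  forall e : eta, V e `<=` W (val e).

End SoftSets.

Definition soft_image (X X' E E' : Type) (phi : E -> E') (rho : X -> X')
    (W : soft_set X E) : soft_set X' (range phi) :=
  fun d => \bigcup_(e in [set e | phi e = val d]) rho @` W e.
Arguments soft_image {X X' E E'} phi rho W.

Record is_soft_topology (X E : Type) (zeta : set (soft_set X E)) : Prop :=
  IsSoftTopology {
    soft_open_empty : zeta (@soft_empty X E);
    soft_open_full : zeta (@soft_full X E);
    soft_open_bigcup : forall F, F `<=` zeta -> zeta (soft_bigcup F);
    soft_open_cap : forall W V, zeta W -> zeta V -> zeta (soft_cap W V) }.

Definition soft_open_nbhd (X E : Type) (zeta : set (soft_set X E)) (x : X)
    (W : soft_set X E) :=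
  zeta W /\ soft_mem x W.

Definition soft_continuous (X X' E E' : Type) (zeta : set (soft_set X E))
    (zeta' : set (soft_set X' E')) (phi : E -> E') (rho : X -> X') :=
  forall x W', soft_open_nbhd zeta' (rho x) W' ->
  exists W, [/\ soft_open_nbhd zeta x W,
                soft_mem (rho x) (soft_image phi rho W)
              & soft_sub_on (soft_image phi rho W) W'].

Definition soft_mul (G : groupType) (E : Type) (U V : soft_set G E) :
    soft_set G E :=
  fun e => [set a * b | a in U e & b in V e].

(* [groupType] includes a choice operator; every type carries one in the
   classical setting, so this does not restrict the underlying groups. *)
Record softTopGroup := SoftTopGroup {
  stg_group :> groupType;
  stg_param : Type;
  stg_open : set (soft_set stg_group stg_param);
  stg_topology : is_soft_topology stg_open;
  stg_mul_continuous : forall (a b : stg_group) W,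
    soft_open_nbhd stg_open (a * b) W ->
    exists U V, [/\ soft_open_nbhd stg_open a U, soft_open_nbhd stg_open b V
                  & soft_sub (soft_mul U V) W];
  stg_inv_continuous :
    soft_continuous stg_open stg_open idfun (fun a : stg_group => a^-1) }.

Record softHom (A B : softTopGroup) := SoftHom {
  hom_param : stg_param A -> stg_param B;
  hom_group : {multiplicative A -> B};
  hom_continuous :
    soft_continuous (@stg_open A) (@stg_open B) hom_param hom_group }.

Lemma softHom_eqP (A B : softTopGroup) (f g : softHom A B) :
  f = g <->
  hom_param f = hom_param g /\ hom_group f = hom_group g :> (A -> B).
Proof.
split=> [-> //|]; case: f g => [p r c] [p' r' c'] /= [ep er].
subst p'; have er' : r = r'.
  case: r r' er {c c'} => [r [[m]]] [r' [[m']]] /= er; subst r'.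
  by rewrite (Prop_irrelevance m m').
by subst r'; rewrite (Prop_irrelevance c c').
Qed.

Record is_category (Ob : Type) (Hom : Ob -> Ob -> Type)
    (id : forall A, Hom A A)
    (comp : forall A B C, Hom B C -> Hom A B -> Hom A C) : Prop :=
  IsCategory {
    cat_compA : forall A B C D (h : Hom C D) (g : Hom B C) (f : Hom A B),
      comp A C D h (comp A B C g f) = comp A B D (comp B C D h g) f;
    cat_comp1f : forall A B (f : Hom A B), comp A B B (id B) f = f;
    cat_compf1 : forall A B (f : Hom A B), comp A A B f (id A) = f }.

(* Main.v *)
Require Import Defs.
From HB Require Import structures.
From mathcomp Require Import all_boot monoid.
From mathcomp Require Import boolp classical_sets.

(** Soft continuity of [(phi, rho)] looks like a condition on images, whose
    parameter set [range phi] changes with [phi] and so does not compose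
    directly.  It is however equivalent to a condition on preimages, taken
    parameter by parameter: every soft open neighborhood [W'] of [rho x] admits
    a soft open neighborhood [W] of [x] such that [rho] maps [W e] into
    [W' (phi e)] for each [e] (lemma [soft_continuousP]).  In that form
    identities are continuous with [W = W'], and continuity of a composite is
    obtained by pulling a neighborhood back twice.  The category laws hold
    because a morphism is determined by its two underlying functions
    ([softHom_eqP]), and composition of functions is associative and unital. *)

(** The clause [rho x] in the image of [W] follows from [x] in [W], because a
    parameter of the image is by definition some [phi e]; and inclusion of the
    union over the fibre of [phi] above [phi e] means inclusion of each term. *)
Lemma soft_continuousP (X X' E E' : Type) (zeta : set (soft_set X E))
    (zeta' : set (soft_set X' E')) (phi : E -> E') (rho : X -> X') :
  soft_continuous zeta zeta' phi rho <->
  forall x W', soft_open_nbhd zeta' (rho x) W' ->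
  exists2 W, soft_open_nbhd zeta x W &
    forall e y, W e y -> W' (phi e) (rho y).
Proof.
split=> cont x W' /cont.
  move=> [W [Wx _ sWW']]; exists W => // e y Wey.
  have phie : range phi (phi e) by exists e.
  (* [phi e] seen as an element of the parameter type of the image *)
  apply: (sWW' (exist _ (phi e) (mem_set phie))).
  by exists e => //; exists y.
move=> [W Wx sWW']; exists W; split=> // [[d d_in]|[d d_in] _ [e /= <-] [y Wey <-]].
  have [e _ phied] := set_mem d_in.
  by exists e => //; exists x => //; case: Wx.
exact: sWW'.
Qed.

Lemma soft_continuous_id (X E : Type) (zeta : set (soft_set X E)) :
  soft_continuous zeta zeta idfun idfun.
Proof. by apply/soft_continuousP => x W Wx; exists W. Qed.

Lemma soft_continuous_comp (X1 X2 X3 E1 E2 E3 : Type)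
    (zeta1 : set (soft_set X1 E1)) (zeta2 : set (soft_set X2 E2))
    (zeta3 : set (soft_set X3 E3)) (phi1 : E1 -> E2) (rho1 : X1 -> X2)
    (phi2 : E2 -> E3) (rho2 : X2 -> X3) :
  soft_continuous zeta2 zeta3 phi2 rho2 ->
  soft_continuous zeta1 zeta2 phi1 rho1 ->
  soft_continuous zeta1 zeta3 (phi2 \o phi1) (rho2 \o rho1).
Proof.
move=> /soft_continuousP cont2 /soft_continuousP cont1.
apply/soft_continuousP => x W3 /cont2[W2 /cont1[W1 W1x sW12] sW23].
by exists W1 => // e y /sW12; apply: sW23.
Qed.

Definition softHom_id (A : softTopGroup) : softHom A A :=
  @SoftHom A A idfun idfun (@soft_continuous_id _ _ _).

Definition softHom_comp (A B C : softTopGroup) (g : softHom B C)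
    (f : softHom A B) : softHom A C :=
  @SoftHom A C (hom_param g \o hom_param f) (hom_group g \o hom_group f)
    (soft_continuous_comp _ _ _ _ _ _ _ _ _ _ _ _ _
       (@hom_continuous _ _ g) (@hom_continuous _ _ f)).

Theorem theorem6p5 :
  exists (id : forall A : softTopGroup, softHom A A)
         (comp : forall A B C : softTopGroup,
            softHom B C -> softHom A B -> softHom A C),
    [/\ forall A : softTopGroup,
          hom_param (id A) = idfun /\ hom_group (id A) = idfun :> (A -> A),
        forall (A B C : softTopGroup) (g : softHom B C) (f : softHom A B),
          hom_param (comp A B C g f) = hom_param g \o hom_param f /\
          hom_group (comp A B C g f) = hom_group g \o hom_group f :> (A -> C)
      & is_category id comp].
Proof.
exists softHom_id, softHom_comp; split=> //.
by split=> *; apply/softHom_eqP.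
Qed.
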